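(* $C_X(\mathcal{A})^*=\operatorname{cl}\{\exp y:\ y\in\mathbb{R}^{\mathcal{A}},\ (y,1)\in G_X(\mathcal{A})^*\}$, where $\exp$ is applied entrywise, $C_X(\mathcal{A})^*\subset\mathbb{R}^{\mathcal{A}}$ and $G_X(\mathcal{A})^*\subset\mathbb{R}^{\mathcal{A}}\times\mathbb{R}$ are dual cones with respect to standard inner products.
   Context: $X\subset\mathbb{R}^n$ is a nonempty closed convex set and $\mathcal{A}\subset\mathbb{R}^n$ is a nonempty finite set such that the functions $x\mapsto\exp(\alpha^Tx)$, $\alpha\in\mathcal{A}$, are linearly independent on $X$. $\mathbb{R}^{\mathcal{A}}$ denotes real vectors indexed by $\mathcal{A}$. $\mathcal{A}\nu=\sum_\alpha\alpha\nu_\alpha$. $\sigma_X(y)=\sup\{y^Tx:x\in X\}$. $N_\beta=\{\nu\in\mathbb{R}^{\mathcal{A}}:\nu_\alpha\ge0\ \forall\alpha\neq\beta,\ \sum_\alpha\nu_\alpha=0\}$. A vector $\nu^\star\in N_\beta$ is an $X$-circuit of $\mathcal{A}$ if (1) $\nu^\star\neq0$, (2) $\sigma_X(-\mathcal{A}\nu^\star)<\infty$, and (3) $\nu^\star$ cannot be written as a convex combination of two non-proportional vectors $\nu^{(1)},\nu^{(2)}\in N_\beta$ such that the map $\nu\mapsto\sigma_X(-\mathcal{A}\nu)$ is affine on the segment $[\nu^{(1)},\nu^{(2)}]$. $\Lambda_X(\mathcal{A})$ is the set of all $X$-circuits $\lambda$ (over all $\beta\in\mathcal{A}$) normalized so that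 the unique negative entry equals $-1$. Signomials $f=\sum_\alpha c_\alpha\mathrm{e}^\alpha$, $\mathrm{e}^\alpha(x)=\exp(\alpha^Tx)$, are identified with $c\in\mathbb{R}^{\mathcal{A}}$; $C_X(\mathcal{A},\beta)$ is the set of $c$ with $f$ nonnegative on $X$ and $c_\alpha\ge0$ for $\alpha\ne\beta$, and $C_X(\mathcal{A})=\sum_{\beta\in\mathcal{A}}C_X(\mathcal{A},\beta)$. The functional form of $\lambda\in\Lambda_X(\mathcal{A})$ is $\phi_\lambda=(\lambda,\sigma_X(-\mathcal{A}\lambda))\in\mathbb{R}^{\mathcal{A}}\times\mathbb{R}$, i.e. $\phi_\lambda(y)=(y,1)^T\phi_\lambda=\sum_\alpha y_\alpha\lambda_\alpha+\sigma_X(-\mathcal{A}\lambda)$. The circuit graph is $G_X(\mathcal{A})=\operatorname{cone}(\{\phi_\lambda:\lambda\in\Lambda_X(\mathcal{A})\}\cup\{(0,1)\})\subset\mathbb{R}^{\mathcal{A}}\times\mathbb{R}$ (the convex conic hull, including the origin). *)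

(* Defs.v *)
From HB Require Import structures.
From mathcomp Require Import all_boot all_order all_algebra.
From mathcomp Require Import all_classical all_reals all_analysis.
Set Implicit Arguments. Unset Strict Implicit. Unset Printing Implicit Defensive.
Import Order.TTheory GRing.Theory Num.Theory.
Import numFieldNormedType.Exports.
Local Open Scope classical_set_scope.
Local Open Scope ring_scope.

(* The finite set A = {alpha_0, ..., alpha_{m-1}} subset R^n is given as an
   indexed family alpha : 'I_m -> 'rV[R]_n; vectors of R^A are 'rV[R]_m,
   the coordinate indexed by alpha_i being entry i. *)

Section Defs.
Variables (R : realType) (n m : nat).
Variable X : set 'rV[R]_n.
Variable alpha : 'I_m -> 'rV[R]_n.

Definition dotv (k : nat) (u v : 'rV[R]_k) : R := \sum_(j < k) u 0 j * v 0 j.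

Definition convex_rV (k : nat) (S : set 'rV[R]_k) : Prop :=
  forall x y (t : R), S x -> S y -> 0 <= t -> t <= 1 -> S (t *: x + (1 - t) *: y).

Definition signomial (c : 'rV[R]_m) (x : 'rV[R]_n) : R :=
  \sum_(i < m) c 0 i * expR (dotv (alpha i) x).

Definition exp_lin_indep : Prop :=
  forall c : 'rV[R]_m, (forall x, X x -> signomial c x = 0) -> c = 0.

Definition sigmaX (y : 'rV[R]_n) : \bar R :=
  ereal_sup [set (dotv y x)%:E | x in X].

Definition Amul (nu : 'rV[R]_m) : 'rV[R]_n := \sum_(i < m) nu 0 i *: alpha i.

Definition sigA (nu : 'rV[R]_m) : \bar R := sigmaX (- Amul nu).

Definition Nbeta (beta : 'I_m) : set 'rV[R]_m :=
  [set nu | (forall i, i != beta -> 0 <= nu 0 i) /\ \sum_(i < m) nu 0 i = 0].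

Definition proportional (u v : 'rV[R]_m) : Prop :=
  exists k : R, u = k *: v \/ v = k *: u.

Definition sigA_affine_on_segment (nu1 nu2 : 'rV[R]_m) : Prop :=
  exists r1 r2 : R, forall s : R, 0 <= s -> s <= 1 ->
    sigA ((1 - s) *: nu1 + s *: nu2) = ((1 - s) * r1 + s * r2)%:E.

Definition is_Xcircuit (beta : 'I_m) (nu : 'rV[R]_m) : Prop :=
  [/\ Nbeta beta nu,
      nu != 0,
      (sigA nu < +oo)%E &
      ~ (exists nu1 nu2 (t : R),
           Nbeta beta nu1 /\ Nbeta beta nu2 /\ ~ proportional nu1 nu2 /\
           0 < t /\ t < 1 /\
           nu = t *: nu1 + (1 - t) *: nu2 /\
           sigA_affine_on_segment nu1 nu2)].

(* Lambda_X(A): circuits normalized so that the negative entry (at beta) is -1 *)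
Definition LambdaX : set 'rV[R]_m :=
  [set lam | exists beta nu, is_Xcircuit beta nu /\ lam = (- nu 0 beta)^-1 *: nu].

Definition phi (lam : 'rV[R]_m) : 'rV[R]_m * R := (lam, fine (sigA lam)).

(* convex conic hull (contains the origin: empty combination) *)
Definition conic_hull (S : set ('rV[R]_m * R)) : set ('rV[R]_m * R) :=
  [set g | exists (k : nat) (c : 'I_k -> R) (p : 'I_k -> 'rV[R]_m * R),
      [/\ forall i, 0 <= c i, forall i, S (p i) &
          g = (\sum_(i < k) c i *: (p i).1, \sum_(i < k) c i * (p i).2)]].

Definition circuit_graph : set ('rV[R]_m * R) :=
  conic_hull ([set phi lam | lam in LambdaX] `|` [set (0, 1)]).

Definition dual_cone_prod (K : set ('rV[R]_m * R)) : set ('rV[R]_m * R) :=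
  [set w | forall g, K g -> 0 <= dotv w.1 g.1 + w.2 * g.2].

Definition dual_cone (K : set 'rV[R]_m) : set 'rV[R]_m :=
  [set y | forall c, K c -> 0 <= dotv y c].

Definition CXbeta (beta : 'I_m) : set 'rV[R]_m :=
  [set c | (forall x, X x -> 0 <= signomial c x) /\
           (forall i, i != beta -> 0 <= c 0 i)].

Definition CX : set 'rV[R]_m :=
  [set c | exists cs : 'I_m -> 'rV[R]_m,
      (forall beta, CXbeta beta (cs beta)) /\ c = \sum_(beta < m) cs beta].

End Defs.

(* Main.v *)
(* If [v > 0] lies in [C_X(A)^*], pairing [v] with the AM/GM exponential that
   a circuit [lam] certifies gives [lam . ln v + sigma_X(-A lam) >= 0]; an
   arbitrary [v] is a limit of such vectors, obtained by adding a small
   multiple of the point evaluation [(exp (alpha^T x0))_alpha].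

   Conversely let [y] satisfy all circuit inequalities.  On
   [{nu in N_beta : nu_beta = -1}] the function [y . nu + sigma_X(-A nu)] has
   compact sublevel sets.  A lexicographic minimiser of it is an extreme point
   of the set of minimisers, and by positive homogeneity such a point is an
   [X]-circuit.  Hence the inequality holds on all of [N_beta].  A theorem of
   the alternative on [X] then yields, for every [e > 0], a point [x] of [X]
   with [y_alpha - y_beta >= (alpha - beta)^T x - e] for all [alpha], which
   compares [exp y] with a multiple of the evaluation at [x]. *)

Require Import Defs.
From HB Require Import structures.
From mathcomp Require Import all_boot all_order all_algebra.
From mathcomp Require Import all_classical all_reals all_analysis.
From mathcomp Require Import ring lra.
Set Implicit Arguments. Unset Strict Implicit. Unset Printing Implicit Defensive.
Import Order.TTheory GRing.Theory Num.Theory.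
Import numFieldNormedType.Exports.
Local Open Scope classical_set_scope.
Local Open Scope ring_scope.

(** * Closed sets, continuity and attained minima *)

Lemma closed_preim_le (R : realType) (T : topologicalType) (f g : T -> R) :
  continuous f -> continuous g -> closed [set x | f x <= g x].
Proof.
move=> fc gc.
have -> : [set x | f x <= g x] = (fun x => g x - f x) @^-1` [set r : R | 0 <= r].
  by apply/seteqP; split=> x /=; rewrite subr_ge0.
apply: preimage_closed; last exact: closed_ge.
by move=> x _; apply: cvgB; [exact: gc|exact: fc].
Qed.

Lemma sum_continuous (R : realType) (T : topologicalType) (k : nat)
    (F : 'I_k -> T -> R) :
  (forall i, continuous (F i)) -> continuous (fun x => \sum_(i < k) F i x).
Proof.
move=> Fc; elim: k F Fc => [|k IH] F Fc.
  have -> : (fun x => \sum_(i < 0) F i x) = cst 0.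
    by apply/funext => x; rewrite big_ord0.
  by move=> x; exact: cvg_cst.
have -> : (fun x => \sum_(i < k.+1) F i x) =
    (fun x => \sum_(i < k) F (widen_ord (leqnSn k) i) x + F ord_max x).
  by apply/funext => x; rewrite big_ord_recr.
by move=> x; apply: cvgD; [apply: IH => i; exact: Fc|exact: Fc].
Qed.

(** Points of [E] outside the sublevel set have values above [c >= f p], so a minimum over the
    compact part is global on [E]. *)
Lemma sublevel_argmin (R : realType) (T : topologicalType) (f : T -> R)
    (E : set T) (c : R) :
  continuous f -> E `&` [set x | f x <= c] !=set0 ->
  compact (E `&` [set x | f x <= c]) ->
  exists p, [/\ E p, f p <= c & forall q, E q -> f p <= f q].
Proof.
move=> fc K0 Kc.
have [p /set_mem[Ep fp] pmin] :=
  compact_EVT_min K0 Kc (continuous_subspaceT fc).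
exists p; split=> // q Eq; have [qc|/ltW cq] := leP (f q) c.
  by apply: pmin; rewrite inE.
exact: le_trans fp cq.
Qed.

Lemma rV_box_compact (R : realType) (k : nat) (l h : 'I_k -> R) :
  compact [set v : 'rV[R]_k | forall i, l i <= v 0 i <= h i].
Proof.
have := @rV_compact R k (fun i => `[l i, h i]%classic) (fun i => @segment_compact R _ _).
congr compact; apply/seteqP; split=> v /= vP i; have := vP i;
  by rewrite in_itv.
Qed.

(** * Faces of compact sets and lexicographic minimisation *)

Section Faces.
Variables (R : realType) (V : normedModType R).
Implicit Types (E S : set V) (f : V -> R).

(** A face in the sense of extreme subsets; its one-point instances are the extreme points of
    [E]. *)
Definition face E S :=
  S `<=` E /\ forall a b (t : R), E a -> E b -> 0 < t -> t < 1 ->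
    S (t *: a + (1 - t) *: b) -> S a /\ S b.

Definition affine_on_lines f :=
  forall a b (t : R), f (t *: a + (1 - t) *: b) = t * f a + (1 - t) * f b.

Lemma face_trans E S S' : face E S -> face S S' -> face E S'.
Proof.
move=> [SE fS] [S'S fS']; split; first exact: subset_trans SE.
move=> a b t Ea Eb t0 t1 S't; have [Sa Sb] := fS a b t Ea Eb t0 t1 (S'S _ S't).
exact: fS' S't.
Qed.

(** A strict convex combination of two values that are at least [f p] can be at most [f p] only if
    both equal [f p]. *)
Lemma argmin_face E f (p : V) : affine_on_lines f ->
  (forall q, E q -> f p <= f q) -> face E (E `&` [set q | f q <= f p]).
Proof.
move=> fa pmin; split=> [x []//|a b t Ea Eb t0 t1 [_ /=]].
rewrite fa => h; have ha := pmin _ Ea; have hb := pmin _ Eb.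
split; split=> //=.
  have : t * (f a - f p) <= 0 by nra.
  by rewrite pmulr_rle0// subr_le0.
have : (1 - t) * (f b - f p) <= 0 by nra.
by rewrite pmulr_rle0 ?subr_gt0// subr_le0.
Qed.

(** Lexicographic minimisation: each function in turn is minimised on the face found so far. If the
    first [k] functions separate points, [S] is a single extreme point. *)
Lemma compact_face E (f : nat -> V -> R) (k : nat) :
  (forall i, continuous (f i)) -> (forall i, affine_on_lines (f i)) ->
  compact E -> E !=set0 ->
  exists S, [/\ face E S, compact S, S !=set0 &
    forall i, (i < k)%N -> forall a b, S a -> S b -> f i a = f i b].
Proof.
move=> fc fa Ec E0; elim: k => [|k [S [fS Sc [p0 Sp0] Seq]]].
  by exists E; split=> //; split.
have cmp c : compact (S `&` [set q | f k q <= c]).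
  apply: compact_closedI => //; apply: closed_preim_le; first exact: fc.
  by move=> x; exact: cvg_cst.
have [|p [Sp _ pmin]] :=
  @sublevel_argmin R V (f k) S (f k p0) (fc k) _ (cmp _); first by exists p0; split => /=.
exists (S `&` [set q | f k q <= f k p]); split.
- exact: face_trans fS (argmin_face (fa k) pmin).
- exact: cmp.
- by exists p; split => /=.
- move=> i; rewrite ltnS leq_eqVlt => /orP[/eqP->|ik] a b [Sa ha] [Sb hb].
    by apply/eqP; rewrite eq_le (le_trans ha (pmin _ Sb)) (le_trans hb (pmin _ Sa)).
  exact: Seq.
Qed.

End Faces.

(** * A theorem of the alternative for affine functions on a convex set *)

Section Alternative.
Variables (R : realType) (U : lmodType R) (m : nat).
Variables (X : set U) (w : 'I_m -> U -> R).
Hypothesis X0 : X !=set0.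
Hypothesis Xconv : forall x y (t : R), X x -> X y -> 0 <= t -> t <= 1 ->
  X (t *: x + (1 - t) *: y).
Hypothesis waff : forall i x y (t : R),
  w i (t *: x + (1 - t) *: y) = t * w i x + (1 - t) * w i y.

(** The closure of the image of [X] under [w], lowered by the nonnegative orthant. The slack [e]
    makes it closed although [X] may be unbounded. *)
Let W := [set u : 'rV[R]_m |
  forall e : R, 0 < e -> exists2 x, X x & forall i, u 0 i <= w i x + e].

Let wW x : X x -> W (\row_i w i x).
Proof. by move=> Xx e e0; exists x => // i; rewrite mxE lerDl ltW. Qed.

Let W_down (u v : 'rV[R]_m) : W u -> (forall i, v 0 i <= u 0 i) -> W v.
Proof.
move=> Wu vu e /Wu[x Xx ux]; exists x => // i; exact: le_trans (vu i) (ux i).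
Qed.

Let W_conv u v t : W u -> W v -> 0 <= t -> t <= 1 -> W (t *: u + (1 - t) *: v).
Proof.
move=> Wu Wv t0 t1 e e0; have [x Xx ux] := Wu e e0; have [y Xy vy] := Wv e e0.
exists (t *: x + (1 - t) *: y); first exact: Xconv.
move=> i; rewrite !mxE waff; have := ux i; have := vy i; nra.
Qed.

Let W_closed : closed W.
Proof.
move=> u Wu e e0; have e20 : 0 < e / 2 by rewrite divr_gt0.
have [v [Wv uv]] := Wu _ (nbhsx_ballx u (e / 2) e20).
have [x Xx vx] := Wv _ e20; exists x => // i.
case: uv => _ uv; have /ltW := uv 0 i.
rewrite /ball/= ler_distl => /andP[_]; have := vx i; lra.
Qed.

Let sq (u : 'rV[R]_m) := \sum_i u 0 i ^+ 2.

Let sq_ge (u : 'rV[R]_m) i : u 0 i ^+ 2 <= sq u.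
Proof.
by rewrite /sq (bigD1 i)//= lerDl sumr_ge0// => j _; exact: sqr_ge0.
Qed.

Let sq_continuous : continuous sq.
Proof.
apply: sum_continuous => i u.
rewrite (_ : (fun v : 'rV[R]_m => v 0 i ^+ 2) = (fun v => v 0 i * v 0 i)); last exact/funext.
by apply: continuousM; exact: coord_continuous.
Qed.

Let W_nearest : exists q, W q /\ forall u, W u -> sq q <= sq u.
Proof.
have [x0 Xx0] := X0; pose u0 := \row_i w i x0; pose c := sq u0.
have [||q [Wq _ qmin]] := @sublevel_argmin R _ sq W c sq_continuous.
- by exists u0; split; [exact: wW|exact: lexx].
(* From [u_i ^+ 2 <= c] follows [|u_i| <= 1 + c], without a square root. *)
- apply: (subclosed_compact _ (@rV_box_compact R m (fun=> - (1 + c)) (fun=> 1 + c))).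
    apply: closedI; first exact: W_closed.
    apply: closed_preim_le; first exact: sq_continuous.
    exact: cst_continuous.
  move=> u [_ /= uc] i; have := le_trans (sq_ge u i) uc.
  by move=> h; apply/andP; split; nra.
- by exists q.
Qed.

(** The conclusion says that [0] lies in [W]. Otherwise the point [q] of [W] nearest to the origin
    separates: [- q] is a nonnegative multiplier violating the hypothesis with [d = sq q]. *)
Lemma convex_alternative :
  (forall mu : 'I_m -> R, (forall i, 0 <= mu i) -> forall d, 0 < d ->
     exists2 x, X x & - d < \sum_i mu i * w i x) ->
  forall e, 0 < e -> exists2 x, X x & forall i, - e <= w i x.
Proof.
move=> H; suff W00 : W 0.
  move=> e /W00[x Xx h]; exists x => // i; have := h i; rewrite mxE; lra.
have [q [Wq qmin]] := W_nearest.
have [q0|qn0] := eqVneq (sq q) 0.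
  suff -> : 0 = q by [].
  apply/rowP => i; rewrite mxE; apply/esym/eqP; rewrite -sqrf_eq0 eq_le sqr_ge0.
  by rewrite andbT -q0 sq_ge.
have sq_ge0 (u : 'rV[R]_m) : 0 <= sq u by apply: sumr_ge0 => i _; exact: sqr_ge0.
have qp : 0 < sq q by rewrite lt_neqAle eq_sym qn0 sq_ge0.
(* Variational inequality of the projection: otherwise a short move from [q] towards [u] would
   decrease the norm. *)
have key (u : 'rV[R]_m) : W u -> sq q <= \sum_i q 0 i * u 0 i.
  move=> Wu; rewrite leNgt; apply/negP => lt.
  pose a := sq q - \sum_i q 0 i * u 0 i; pose D := sq (u - q).
  have a0 : 0 < a by rewrite subr_gt0.
  have D0 : 0 <= D by exact: sq_ge0.
  (* The squared norm changes by [t * (t * D - 2 * a)], and this [t] gives [t * D < a]; adding [a]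
     to the denominator covers [D = 0] and keeps [t <= 1]. *)
  pose t := a / (D + a).
  have Da : 0 < D + a by lra.
  have t0 : 0 < t by rewrite divr_gt0.
  have t1 : t <= 1 by rewrite ler_pdivrMr// mul1r; lra.
  have tD : t * (D + a) = a by rewrite divfK// gt_eqF.
  have := qmin _ (W_conv Wu Wq (ltW t0) t1).
  have -> : sq (t *: u + (1 - t) *: q) = sq q - 2 * t * a + t ^+ 2 * D.
    rewrite /D /a /sq -sumrB !mulr_sumr -sumrB -big_split/=.
    by apply: eq_bigr => i _; rewrite !mxE; ring.
  have : t * (t * D) < t * (2 * a) by rewrite ltr_pM2l//; nra.
  nra.
(* [W] allows lowering coordinate [i], so [key] applies at [q] minus a unit vector. *)
have q_le0 i : q 0 i <= 0.
  have Wqi : W (q - delta_mx 0 i).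
    apply: (W_down Wq) => j; rewrite !mxE eqxx/=; case: (j == i) => /=; lra.
  suff e : \sum_j q 0 j * (q - delta_mx 0 i) 0 j = sq q - q 0 i.
    by have := key _ Wqi; rewrite e; lra.
  rewrite /sq; under eq_bigr do rewrite !mxE eqxx/= mulrBr -expr2.
  rewrite sumrB; congr (_ - _).
  by rewrite (bigD1 i)//= eqxx mulr1 big1 ?addr0// => j /negPf->; rewrite mulr0.
have [i|x Xx] := H (fun i => - q 0 i) _ (sq q) qp; first by rewrite oppr_ge0.
have -> : \sum_i - q 0 i * w i x = - \sum_i q 0 i * (\row_i w i x) 0 i.
  by rewrite -sumrN; apply: eq_bigr => i _; rewrite mxE mulNr.
by have := key _ (wW Xx); lra.
Qed.

End Alternative.

(** * Support functions, normalised circuits and the dual of the circuit graph *)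

Section CircuitDuality.
Variables (R : realType) (n m : nat) (X : set 'rV[R]_n).
Variable alpha : 'I_m -> 'rV[R]_n.

Lemma dotvDr (k : nat) (u x y : 'rV[R]_k) (a b : R) :
  dotv u (a *: x + b *: y) = a * dotv u x + b * dotv u y.
Proof.
rewrite /dotv !mulr_sumr -big_split/=; apply: eq_bigr => i _.
by rewrite !mxE; ring.
Qed.

Lemma dotvZr (k : nat) (u x : 'rV[R]_k) (a : R) :
  dotv u (a *: x) = a * dotv u x.
Proof. by rewrite -[a *: x]addr0 -(scale0r 0) dotvDr mul0r addr0. Qed.

Lemma dotvC (k : nat) (u v : 'rV[R]_k) : dotv u v = dotv v u.
Proof. by apply: eq_bigr => i _; rewrite mulrC. Qed.

Lemma dotv_sumr (k l : nat) (u : 'rV[R]_k) (v : 'I_l -> 'rV[R]_k) :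
  dotv u (\sum_i v i) = \sum_i dotv u (v i).
Proof.
rewrite /dotv exchange_big; apply: eq_bigr => j _.
by rewrite summxE mulr_sumr.
Qed.

Lemma dotv_continuous (k : nat) (u : 'rV[R]_k) : continuous (dotv u).
Proof.
apply: sum_continuous => i x.
by apply: continuousM; [exact: cst_continuous|exact: coord_continuous].
Qed.

Lemma dotvNAmul (nu : 'rV[R]_m) x :
  dotv (- Amul alpha nu) x = - \sum_i nu 0 i * dotv (alpha i) x.
Proof.
have AE j : (- Amul alpha nu) 0 j = - \sum_i nu 0 i * alpha i 0 j.
  by rewrite mxE summxE; congr (- _); apply: eq_bigr => i _; rewrite mxE.
rewrite /dotv; under eq_bigr do rewrite AE mulNr mulr_suml.
rewrite sumrN exchange_big/=; congr (- _); apply: eq_bigr => i _.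
by rewrite mulr_sumr; apply: eq_bigr => j _; rewrite mulrA.
Qed.

Lemma sigA_leP (nu : 'rV[R]_m) (r : R) :
  (sigA X alpha nu <= r%:E)%E <->
  forall x, X x -> - \sum_i nu 0 i * dotv (alpha i) x <= r.
Proof.
split=> [/ereal_supP h x Xx|h].
  by rewrite -dotvNAmul -lee_fin; apply: h; exists x.
by apply: ge_ereal_sup => _ [x Xx <-]; rewrite lee_fin dotvNAmul; exact: h.
Qed.

Lemma sigA_le_scale (nu : 'rV[R]_m) (a r : R) : 0 <= a ->
  (sigA X alpha nu <= r%:E)%E -> (sigA X alpha (a *: nu) <= (a * r)%:E)%E.
Proof.
move=> a0 /sigA_leP h; apply/sigA_leP => x /h.
under [X in _ -> - X <= _]eq_bigr do rewrite mxE -mulrA.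
by rewrite -mulr_sumr -mulrN => /(ler_wpM2l a0).
Qed.

Lemma sigA_fineK (nu : 'rV[R]_m) : X !=set0 -> (sigA X alpha nu < +oo)%E ->
  sigA X alpha nu = (fine (sigA X alpha nu))%:E.
Proof.
move=> [x Xx] lty; rewrite fineK// fin_numE -ltey lty andbT -ltNye.
apply: lt_le_trans (ltNyr (dotv (- Amul alpha nu) x)) _.
by apply: ereal_sup_ubound; exists x.
Qed.

(** Otherwise all entries are nonnegative with sum zero. This justifies dividing by [- nu 0 b]. *)
Lemma Nbeta_lt0 b (nu : 'rV[R]_m) : Nbeta b nu -> nu != 0 -> nu 0 b < 0.
Proof.
move=> [nu_ge0 nu_sum] nu0; rewrite ltNge; apply: contra nu0 => b_ge0.
have ge0 i : 0 <= nu 0 i by have [->|] := eqVneq i b; [|exact: nu_ge0].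
apply/eqP/rowP => i; rewrite mxE.
exact: (psumr_eq0P (fun i _ => ge0 i) nu_sum).
Qed.

Lemma Nbeta_scale b (nu : 'rV[R]_m) a : 0 <= a -> Nbeta b nu -> Nbeta b (a *: nu).
Proof.
move=> a0 [h s]; split=> [i ib|]; first by rewrite mxE mulr_ge0// h.
by under eq_bigr do rewrite mxE; rewrite -mulr_sumr s mulr0.
Qed.

Lemma LambdaX_Nbeta lam : X !=set0 -> LambdaX X alpha lam ->
  exists b, [/\ Nbeta b lam, lam 0 b = -1 & (sigA X alpha lam < +oo)%E].
Proof.
move=> X0 [b [nu [[Nnu nu0 fin _] ->]]]; exists b.
have nub := Nbeta_lt0 Nnu nu0.
have a0 : 0 <= (- nu 0 b)^-1 by rewrite invr_ge0 oppr_ge0 ltW.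
split; first exact: Nbeta_scale.
  by rewrite mxE invrN mulNr mulVf// lt_eqF.
apply: le_lt_trans (ltry ((- nu 0 b)^-1 * fine (sigA X alpha nu))).
by apply: sigA_le_scale => //; rewrite -sigA_fineK.
Qed.

Definition circuit_feasible (y : 'rV[R]_m) :=
  forall lam, LambdaX X alpha lam -> 0 <= dotv y lam + fine (sigA X alpha lam).

(** Nonnegativity need only be tested on generators, and [(0, 1)] pairs to [1] with [(y, 1)]. *)
Lemma dual_circuit_graphP (y : 'rV[R]_m) :
  dual_cone_prod (circuit_graph X alpha) (y, 1) <-> circuit_feasible y.
Proof.
split=> [h lam Llam|h _ [k [c [p [c0 Sp ->]]]]] /=.
  have /= := h (lam, fine (sigA X alpha lam)); rewrite mul1r; apply.
  exists 1%N, (fun=> 1), (fun=> phi X alpha lam); split=> //.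
    by move=> _; left; exists lam.
  by rewrite !big_ord1 scale1r mul1r.
rewrite dotv_sumr mul1r -big_split/= sumr_ge0// => i _.
rewrite dotvZr -mulrDr mulr_ge0//.
have [[lam Llam <-]|->] /= := Sp i; first exact: h.
by rewrite /dotv big1 ?add0r// => j _; rewrite mxE mulr0.
Qed.

(** * Minimisers on the normalised slice of [Nbeta b] *)

Section Minimisation.
Variables (y : 'rV[R]_m) (b : 'I_m).
Hypothesis X0 : X !=set0.

(** The epigraph of [sigA] on the slice. Passing to pairs replaces an extended-valued convex
    objective by the continuous affine [f]. *)
Let E := [set p : 'rV[R]_m * R |
  [/\ Nbeta b p.1, p.1 0 b = -1 & (sigA X alpha p.1 <= p.2%:E)%E]].

Let f (p : 'rV[R]_m * R) := dotv y p.1 + p.2.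

Let coord1_continuous i : continuous (fun p : 'rV[R]_m * R => p.1 0 i).
Proof.
move=> p; apply: (@continuous_comp _ _ _ fst (fun u : 'rV[R]_m => u 0 i)).
  exact: cvg_fst.
exact: coord_continuous.
Qed.

Let f_continuous : continuous f.
Proof.
move=> p; apply: (@continuousD R R _ (fun q : 'rV[R]_m * R => dotv y q.1) snd p); last exact: cvg_snd.
apply: (@continuous_comp _ _ _ fst (dotv y)); first exact: cvg_fst.
exact: dotv_continuous.
Qed.

(** An intersection of closed half-spaces; the bound on [sigA] contributes one for each point of
    [X]. *)
Let E_closed : closed E.
Proof.
pose le (g h : 'rV[R]_m * R -> R) := [set p | g p <= h p].
have -> : E = \bigcap_(i in [set i | i != b]) le (fun=> 0) (fun p => p.1 0 i) `&`
    (le (fun p => \sum_i p.1 0 i) (fun=> 0) `&`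
    (le (fun=> 0) (fun p => \sum_i p.1 0 i) `&`
    (le (fun p => p.1 0 b) (fun=> -1) `&`
    (le (fun=> -1) (fun p => p.1 0 b) `&`
    \bigcap_(x in X)
      le (fun p => - \sum_i p.1 0 i * dotv (alpha i) x) (fun p => p.2))))).
  apply/seteqP; split=> [p [[h1 h2] h3 /sigA_leP h4]|].
    by do 5 (split; first by rewrite /le/= ?h2 ?h3); exact: h4.
  move=> p [h1 [h2 [h3 [h4 [h5 h6]]]]].
  by split; [split=> //; exact/le_anti/andP|exact/le_anti/andP|exact/sigA_leP].
have c1 := sum_continuous coord1_continuous.
have cc (r : R) : continuous (fun _ : 'rV[R]_m * R => r) by exact: cst_continuous.
repeat apply: closedI; try exact: closed_preim_le.
  by apply: closed_bigI => i _; exact: closed_preim_le.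
apply: closed_bigI => x _; apply: closed_preim_le; last first.
  by move=> p; exact: cvg_snd.
move=> p; apply: continuousN; apply: sum_continuous => i q.
apply: (@continuousM R _ (fun p : 'rV[R]_m * R => p.1 0 i) (fun=> dotv (alpha i) x)).
  exact: coord1_continuous.
exact: cc.
Qed.

Let E_bound p i : E p -> `|p.1 0 i| <= 1.
Proof.
move=> [[ge0 sum0] pb _]; have [->|ib] := eqVneq i b.
  by rewrite pb normrN1.
rewrite ger0_norm ?ge0//; move: sum0.
rewrite (bigD1 b)//= (bigD1 i)//= pb => /eqP.
have : 0 <= \sum_(j | (j != b) && (j != i)) p.1 0 j.
  by apply: sumr_ge0 => j /andP[/ge0].
by move=> h /eqP; lra.
Qed.

Let normM_bound p (h : 'I_m -> R) : E p ->
  `|\sum_i p.1 0 i * h i| <= \sum_i `|h i|.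
Proof.
move=> Ep; apply: le_trans (ler_norm_sum _ _ _) _; apply: ler_sum => i _.
by rewrite normrM ler_piMl// E_bound.
Qed.

Let E_sublevel_compact c : compact (E `&` [set p | f p <= c]).
Proof.
have [x Xx] := X0.
(* A single point of [X] bounds [sigA], hence [p.2], from below; [f p <= c] bounds [p.2] from
   above. *)
pose lo := - \sum_i `|dotv (alpha i) x|; pose hi := c + \sum_i `|y 0 i|.
apply: (subclosed_compact _ (compact_setX
  (@rV_box_compact R m (fun=> -1) (fun=> 1)) (@segment_compact R lo hi))).
  apply: closedI => //; apply: closed_preim_le => //; exact: cst_continuous.
move=> p [Ep /= fp]; split=> [i|] /=.
  by rewrite -ler_norml E_bound.
have /ler_normlP[h1 _] := normM_bound (y 0) Ep.
have /ler_normlP[_ h2] := normM_bound (fun i => dotv (alpha i) x) Ep.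
have [_ _ /sigA_leP/(_ x Xx) h3] := Ep.
rewrite in_itv/=; apply/andP; split; first by rewrite /lo; lra.
by move: fp; rewrite /f dotvC /dotv /hi; lra.
Qed.

(** A forbidden decomposition of [q.1], rescaled to the slice, writes [q] as a strict convex
    combination of points of [E]. Both then lie in a face on which the first component is constant,
    which forces proportionality. *)
Lemma normalised_min_circuit (p : 'rV[R]_m * R) : E p ->
  exists q, [/\ E q, f q <= f p & LambdaX X alpha q.1].
Proof.
move=> Ep.
have [|p0 [Ep0 p0p p0min]] := @sublevel_argmin R _ f E (f p) f_continuous _
  (@E_sublevel_compact (f p)); first by exists p; split => /=.
have faff : affine_on_lines f.
  by move=> u v t; rewrite /f/= dotvDr -![_ *: _]/(_ * _); ring.
(* Coordinates extended to all natural indices by the default [0]; only indices below [m] are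
   minimised. *)
pose g k (q : 'rV[R]_m * R) := oapp (fun i => q.1 0 i) 0 (insub k).
have gc k : continuous (g k).
  rewrite /g; case: insubP => [i _ _|_] /=; first exact: coord1_continuous.
  exact: cst_continuous.
have ga k : affine_on_lines (g k).
  rewrite /g => u v t; case: insubP => [i _ _|_] /=; first by rewrite !mxE.
  by rewrite !mulr0 addr0.
have [|S [SF _ [q Sq] Seq]] := @compact_face R _ _ g m gc ga
  (E_sublevel_compact (c := f p0)); first by exists p0; split => /=.
have [SE Sface] := face_trans (argmin_face faff p0min) SF.
have [_ /= qp0] := SF.1 _ Sq.
have [Nq qb sq] := SE _ Sq.
exists q; split; [exact: SE|exact: le_trans p0p|].
have q0 : q.1 != 0.
  by apply/eqP => q0; move: qb; rewrite q0 mxE => /eqP; rewrite eq_sym oppr_eq0 oner_eq0.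
exists b, q.1; rewrite qb opprK invr1 scale1r; split=> //; split=> //.
  exact: le_lt_trans sq (ltry _).
move=> [nu1 [nu2 [t [N1 [N2 [npr [t0 [t1 [qE [r1 [r2 aff]]]]]]]]]]].
have nu1n0 : nu1 != 0.
  by apply/eqP => nu1_0; apply: npr; exists 0; left; rewrite scale0r.
have nu2n0 : nu2 != 0.
  by apply/eqP => nu2_0; apply: npr; exists 0; right; rewrite scale0r.
pose a1 := - nu1 0 b; pose a2 := - nu2 0 b.
have a1_gt0 : 0 < a1 by rewrite oppr_gt0 Nbeta_lt0.
have a2_gt0 : 0 < a2 by rewrite oppr_gt0 Nbeta_lt0.
have aE : t * a1 + (1 - t) * a2 = 1.
  by move: qb; rewrite qE !mxE /a1 /a2; lra.
have s1 : sigA X alpha nu1 = r1%:E.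
  have := aff 0 (lexx _) ler01.
  by rewrite subr0 scale1r scale0r addr0 mul1r mul0r addr0.
have s2 : sigA X alpha nu2 = r2%:E.
  have := aff 1 ler01 (lexx _).
  by rewrite subrr scale1r scale0r add0r mul1r mul0r add0r.
have d_ge0 : t * r1 + (1 - t) * r2 <= q.2.
  have t'0 : 0 <= 1 - t by lra.
  have t'1 : 1 - t <= 1 by lra.
  have := aff (1 - t) t'0 t'1; rewrite subKr -qE => h.
  by rewrite -lee_fin -h.
(* The excess of [q.2] over [sigA] at [q.1], given to both endpoints so that [q] is recovered
   exactly. *)
pose d := q.2 - (t * r1 + (1 - t) * r2).
have d0 : 0 <= d by rewrite subr_ge0.
pose p1 : 'rV[R]_m * R := (a1^-1 *: nu1, a1^-1 * (r1 + d)).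
pose p2 : 'rV[R]_m * R := (a2^-1 *: nu2, a2^-1 * (r2 + d)).
have Ep1 : E p1.
  split; first by apply: Nbeta_scale => //; rewrite invr_ge0 ltW.
    by rewrite /= mxE /a1 invrN mulNr mulVf// -oppr_eq0 gt_eqF.
  by apply: sigA_le_scale; [rewrite invr_ge0 ltW|rewrite s1 lee_fin lerDl].
have Ep2 : E p2.
  split; first by apply: Nbeta_scale => //; rewrite invr_ge0 ltW.
    by rewrite /= mxE /a2 invrN mulNr mulVf// -oppr_eq0 gt_eqF.
  by apply: sigA_le_scale; [rewrite invr_ge0 ltW|rewrite s2 lee_fin lerDl].
(* Rescaling the endpoints by [a1] and [a2] turns the weights into [t * a1] and [(1 - t) * a2],
   which still sum to one. *)
have ta : 1 - t * a1 = (1 - t) * a2 by move: aE; lra.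
have ta0 : 0 < t * a1 by rewrite mulr_gt0.
have ta1 : t * a1 < 1 by rewrite -subr_gt0 ta mulr_gt0// subr_gt0.
have qpp : q = (t * a1) *: p1 + (1 - t * a1) *: p2.
  rewrite ta [LHS]surjective_pairing; congr pair => /=.
    by rewrite !scalerA -!mulrA !mulfV ?gt_eqF// !mulr1.
  rewrite -![_ *: _]/(_ * _) !mulrA -!(mulrA _ _ _^-1) !mulfV ?gt_eqF// !mulr1.
  by rewrite /d; ring.
have [Sp1 Sp2] : S p1 /\ S p2.
  by apply: (Sface _ _ (t * a1)) => //; rewrite -qpp.
apply: npr; exists (a1 / a2); left.
have e : a1^-1 *: nu1 = a2^-1 *: nu2.
  apply/rowP => i; have := Seq i (ltn_ord i) _ _ Sp1 Sp2.
  by rewrite /g valK.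
by rewrite -scalerA -e scalerA mulfV ?gt_eqF// scale1r.
Qed.

End Minimisation.

(** By homogeneity [nu] may be scaled to the slice, where some circuit has a value no larger than
    that of the scaled pair. *)
Lemma circuit_feasible_Nbeta y b (nu : 'rV[R]_m) (s : R) : X !=set0 ->
  circuit_feasible y -> Nbeta b nu -> (sigA X alpha nu <= s%:E)%E ->
  0 <= dotv y nu + s.
Proof.
move=> X0 hy Nnu nus; have [nu0|nu0] := eqVneq nu 0.
  have [x Xx] := X0; move/sigA_leP : nus => /(_ x Xx).
  rewrite nu0 big1 ?oppr0 => [s0|i _]; last by rewrite mxE mul0r.
  by rewrite /dotv big1 ?add0r// => i _; rewrite mxE mulr0.
have nub := Nbeta_lt0 Nnu nu0; pose a := (- nu 0 b)^-1.
have a_gt0 : 0 < a by rewrite invr_gt0 oppr_gt0.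
have [|q [[_ _ sq] /= fq Lq]] :=
    @normalised_min_circuit y b X0 (a *: nu, a * s).
  split; first exact/Nbeta_scale/Nnu/ltW.
    by rewrite /= mxE /a invrN mulNr mulVf// lt_eqF.
  exact/sigA_le_scale/nus/ltW.
rewrite -(pmulr_rge0 _ a_gt0) mulrDr -dotvZr; apply: le_trans fq.
apply: le_trans (hy _ Lq) _; rewrite lerD2l -lee_fin -sigA_fineK//.
exact: le_lt_trans sq (ltry _).
Qed.

End CircuitDuality.

(** * The dual of the signomial cone and exponentials of feasible points *)

Section DualCone.
Variables (R : realType) (n m : nat) (X : set 'rV[R]_n).
Variable alpha : 'I_m -> 'rV[R]_n.

Lemma dual_CXP (v : 'rV[R]_m) :
  dual_cone (CX X alpha) v <->
  forall b c, CXbeta X alpha b c -> 0 <= dotv v c.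
Proof.
split=> [h b c Cc|h _ [cs [Ccs ->]]]; last first.
  by rewrite dotv_sumr sumr_ge0// => b _; exact: h (Ccs b).
apply: h; exists (fun b' => if b' == b then c else 0); split; last first.
  by rewrite -big_mkcond big_pred1_eq.
move=> b'; case: eqP => [->//|_]; split=> [x _|i _]; last by rewrite mxE.
by rewrite /signomial big1// => i _; rewrite mxE mul0r.
Qed.

Lemma dual_CX_closed : closed (dual_cone (CX X alpha)).
Proof.
have -> : dual_cone (CX X alpha) =
    \bigcap_(c in CX X alpha) [set v | 0 <= dotv c v].
  by apply/seteqP; split=> v h c /h; rewrite dotvC.
apply: closed_bigI => c _; apply: closed_preim_le.
  exact: cst_continuous.
exact: dotv_continuous.
Qed.

(** Each single exponential is itself a signomial in the cone. *)
Lemma dual_CX_ge0 (v : 'rV[R]_m) i : dual_cone (CX X alpha) v -> 0 <= v 0 i.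
Proof.
move=> /dual_CXP/(_ i (delta_mx 0 i)); rewrite /dotv (bigD1 i)//= mxE !eqxx mulr1.
rewrite big1 ?addr0 => [|j /negPf ji]; last by rewrite mxE ji andbF mulr0.
apply; split=> [x _|j _]; last by rewrite mxE ler0n.
by apply: sumr_ge0 => j _; rewrite mulr_ge0 ?expR_ge0// mxE ler0n.
Qed.

(** The tangent line of the exponential at the weighted mean [T] lies below it; averaging removes
    the linear term. *)
Lemma expR_jensen (I : finType) (P : pred I) (l t : I -> R) :
  (forall i, P i -> 0 <= l i) -> \sum_(i | P i) l i = 1 ->
  expR (\sum_(i | P i) l i * t i) <= \sum_(i | P i) l i * expR (t i).
Proof.
move=> l0 l1; set T := \sum_(i | P i) l i * t i.
have -> : expR T = \sum_(i | P i) l i * (expR T * (1 + (t i - T))).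
  under eq_bigr => i _ do rewrite mulrCA mulrDr mulr1 mulrBr addrA.
  rewrite -mulr_sumr sumrB big_split/= -mulr_suml l1 -/T.
  by rewrite mul1r addrK mulr1.
apply: ler_sum => i /l0 li; rewrite ler_wpM2l//.
rewrite -[X in _ <= expR X](addrNK T) (addrC _ T) expRD ler_wpM2l ?expR_ge0//.
exact: expR_ge1Dx.
Qed.

(* The test signomial is the AM/GM exponential with coefficients
   [lam_i / v_i] ([i != b]), its inner coefficient being the optimal one. *)
Lemma dual_CX_circuit_feasible (v : 'rV[R]_m) : X !=set0 ->
  dual_cone (CX X alpha) v -> (forall i, 0 < v 0 i) ->
  circuit_feasible X alpha (map_mx (@ln R) v).
Proof.
move=> X0 /dual_CXP dv v0 lam Llam.
have [b [[lam0 lamS] lamb fin]] := LambdaX_Nbeta X0 Llam.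
have /sigA_leP sx : (sigA X alpha lam <= (fine (sigA X alpha lam))%:E)%E.
  by rewrite -sigA_fineK.
move: sx; set s := fine _ => sx.
have lam1 : \sum_(i | i != b) lam 0 i = 1.
  by move: lamS; rewrite (bigD1 b)//= lamb; lra.
pose L := \sum_(i | i != b) lam 0 i * ln (v 0 i) + s.
have -> : dotv (map_mx (@ln R) v) lam + s = L - ln (v 0 b).
  rewrite /dotv (bigD1 b)//= mxE lamb.
  under eq_bigr do rewrite mxE mulrC.
  by rewrite /L; ring.
pose c : 'rV[R]_m := \row_i if i == b then - expR (- L) else lam 0 i / v 0 i.
have cE i : i != b -> c 0 i = lam 0 i / v 0 i.
  by rewrite mxE => /negPf->.
have cb : c 0 b = - expR (- L) by rewrite mxE eqxx.
have vcE : dotv v c = 1 - expR (ln (v 0 b) - L).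
  rewrite /dotv (bigD1 b)//= cb expRD lnK ?posrE// -lam1 mulrN addrC.
  congr (_ - _); apply: eq_bigr => i /cE->.
  by rewrite mulrCA mulfV ?mulr1// gt_eqF.
suff : CXbeta X alpha b c.
  by move=> /dv; rewrite vcE subr_ge0 -expR0 ler_expR; lra.
split=> [x Xx|i ib]; last by rewrite cE// divr_ge0 ?lam0// ltW.
have := expR_jensen (fun i => dotv (alpha i) x - ln (v 0 i)) lam0 lam1.
have -> : \sum_(i | i != b) lam 0 i * expR (dotv (alpha i) x - ln (v 0 i)) =
    \sum_(i | i != b) c 0 i * expR (dotv (alpha i) x).
  apply: eq_bigr => i /cE->; rewrite expRD expRN lnK ?posrE//; ring.
rewrite /signomial [X in _ -> _ <= X](bigD1 b)//= cb => J.
(* Comparing exponents leaves exactly the bound [sx] at the point [x]. *)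
suff : expR (- L) * expR (dotv (alpha b) x) <=
    expR (\sum_(i | i != b) lam 0 i * (dotv (alpha i) x - ln (v 0 i))) by lra.
rewrite -expRD ler_expR /L.
have := sx x Xx; rewrite (bigD1 b)//= lamb.
under [in X in _ -> _ <= X]eq_bigr do rewrite mulrBr.
by rewrite sumrB; lra.
Qed.

(** A multiplier [mu] obstructing the alternative would give a vector of [Nbeta b] whose
    circuit-type inequality fails by [d]. *)
Lemma circuit_feasible_approx (y : 'rV[R]_m) b : X !=set0 -> convex_rV X ->
  circuit_feasible X alpha y -> forall e, 0 < e -> exists2 x, X x &
  forall i, - e <= y 0 i - y 0 b - (dotv (alpha i) x - dotv (alpha b) x).
Proof.
move=> X0 Xconv fy; apply: convex_alternative => //.
  by move=> i x z t; rewrite !dotvDr; ring.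
move=> mu mu0 d d0; apply: contrapT => no.
pose M := \sum_i mu i.
(* Subtracting the total mass at [b] makes the sum zero and turns pairings with [h] into pairings of
   [mu] with [h i - h b]. *)
pose nu : 'rV[R]_m := \row_i (mu i - (if i == b then M else 0)).
have sum_nu (h : 'I_m -> R) : \sum_i nu 0 i * h i = \sum_i mu i * (h i - h b).
  under eq_bigr do rewrite mxE mulrBl.
  under [RHS]eq_bigr do rewrite mulrBr.
  rewrite !sumrB; congr (_ - _); rewrite -mulr_suml (bigD1 b)//= eqxx big1 ?addr0//.
  by move=> i /negPf->; rewrite mul0r.
have Nnu : Nbeta b nu.
  split=> [i /negPf ib|]; first by rewrite mxE ib subr0.
  have := sum_nu (fun=> 1); under eq_bigr do rewrite mulr1.
  by move=> ->; rewrite big1// => i _; rewrite subrr mulr0.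
have sig : (sigA X alpha nu <= (- d - dotv y nu)%:E)%E.
  apply/sigA_leP => x Xx.
  have : \sum_i mu i * (y 0 i - y 0 b - (dotv (alpha i) x - dotv (alpha b) x)) <= - d.
    by rewrite leNgt; apply/negP => lt; apply: no; exists x.
  have -> : \sum_i mu i * (y 0 i - y 0 b - (dotv (alpha i) x - dotv (alpha b) x)) =
      \sum_i nu 0 i * (y 0 i - dotv (alpha i) x).
    by rewrite sum_nu; apply: eq_bigr => i _; ring.
  under eq_bigr do rewrite mulrBr.
  by rewrite sumrB dotvC /dotv; lra.
by have := circuit_feasible_Nbeta X0 fy Nnu sig; lra.
Qed.

(** Multiplying [f(x) >= 0] by [exp(y_b - alpha_b . x)] makes the [b] term equal to [Q], while an
    approximation error of [ln t] costs the other terms at most a factor [t]; then [t] is taken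
    close to [1]. *)
Lemma circuit_feasible_dual_CX (y : 'rV[R]_m) : X !=set0 -> convex_rV X ->
  circuit_feasible X alpha y -> dual_cone (CX X alpha) (map_mx (@expR R) y).
Proof.
move=> X0 Xconv fy; apply/dual_CXP => b c [f0 c0].
pose P := \sum_(i | i != b) c 0 i * expR (y 0 i); pose Q := c 0 b * expR (y 0 b).
have -> : dotv (map_mx (@expR R) y) c = Q + P.
  by rewrite dotvC /dotv (bigD1 b)//= mxE; under eq_bigr do rewrite mxE.
have P0 : 0 <= P by apply: sumr_ge0 => i /c0 ci; rewrite mulr_ge0 ?expR_ge0.
have key t : 1 < t -> 0 <= Q + t * P.
  move=> t1; have t0 : 0 < t by exact: lt_trans t1.
  have [x Xx hx] := circuit_feasible_approx b X0 Xconv fy (ln_gt0 t1).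
  have := f0 x Xx; rewrite /signomial (bigD1 b)//= => fx.
  have := mulr_ge0 (expR_ge0 (y 0 b - dotv (alpha b) x)) fx.
  rewrite mulrDr mulrCA -expRD subrK -/Q => /le_trans; apply.
  rewrite lerD2l /P !mulr_sumr; apply: ler_sum => i ib.
  rewrite mulrCA (mulrCA t) ler_wpM2l ?c0// -expRD -[X in X * _]lnK ?posrE//.
  by rewrite -expRD ler_expR; have := hx i; lra.
rewrite leNgt; apply/negP => QP.
have P1 : 0 < P + 1 by lra.
(* Chosen so that [d * P < - (Q + P)], contradicting [key] at [t = 1 + d]. *)
pose d := - (Q + P) / (2 * (P + 1)).
have d0 : 0 < d by rewrite divr_gt0 ?mulr_gt0// oppr_gt0.
have dE : d * (2 * (P + 1)) = - (Q + P) by rewrite divfK// gt_eqF// mulr_gt0.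
have := key (1 + d); rewrite ltrDl => /(_ d0); nra.
Qed.

End DualCone.

Theorem theorem5p4 (R : realType) (n m : nat) (X : set 'rV[R]_n)
    (alpha : 'I_m -> 'rV[R]_n) :
  X !=set0 -> closed X -> convex_rV X ->
  (0 < m)%N ->
  exp_lin_indep X alpha ->
  dual_cone (CX X alpha) =
  closure [set map_mx (@expR R) y | y in
             [set y : 'rV[R]_m | dual_cone_prod (circuit_graph X alpha) (y, 1)]].
Proof.
move=> X0 _ Xconv _ _; apply/seteqP; split=> v; last first.
  move=> /(@closureS _ _ (dual_cone (CX X alpha)) _ _) clv.
  apply: dual_CX_closed; apply: clv => _ [y /= /dual_circuit_graphP fy <-].
  exact: circuit_feasible_dual_CX.
move=> dv B /nbhs_ballP[e /= e0 eB].
have [x0 Xx0] := X0.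
(* Evaluation at [x0] is a strictly positive element of the dual cone; adding a multiple of it makes
   logarithms available. *)
pose u : 'rV[R]_m := \row_i expR (dotv (alpha i) x0).
have u0 i : 0 < u 0 i by rewrite mxE expR_gt0.
have su0 : 0 < 1 + \sum_i u 0 i.
  by rewrite ltr_pwDl// sumr_ge0// => i _; exact: ltW.
(* Every entry of [u] is below the denominator, so each entry of [d *: u] is below [e]. *)
pose d := e / (1 + \sum_i u 0 i).
have d0 : 0 < d by rewrite divr_gt0.
pose w := v + d *: u.
have wi i : w 0 i = v 0 i + d * u 0 i by rewrite !mxE.
have w0 i : 0 < w 0 i.
  by rewrite wi ltr_wpDl ?(mulr_gt0 d0)//; exact: dual_CX_ge0 i dv.
have dw : dual_cone (CX X alpha) w.
  apply/dual_CXP => b c Cc; have vc := (dual_CXP X alpha v).1 dv b c Cc.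
  rewrite dotvC /w -[v]scale1r dotvDr mul1r dotvC addr_ge0// mulr_ge0 ?(ltW d0)//.
  have := Cc.1 x0 Xx0; congr (_ <= _).
  by apply: eq_bigr => i _; rewrite mxE.
exists w; split.
  exists (map_mx (@ln R) w).
    exact/dual_circuit_graphP/dual_CX_circuit_feasible.
  by apply/rowP => i; rewrite mxE [X in expR X]mxE lnK ?posrE.
apply: eB; split=> // i j; rewrite /ball/= (ord1 i) wi opprD addNKr normrN.
rewrite gtr0_norm ?(mulr_gt0 d0)// /d mulrAC ltr_pdivrMr// ltr_pM2l//.
rewrite (bigD1 j)//= addrCA ltrDl ltr_pwDl// sumr_ge0// => k _.
exact: ltW.
Qed.
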